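(* Let $(X,\mathcal{A})$ be a measurable space with $X$ non-empty, and let $\mathcal{I}$ be the set of all ideals of the ring $\mathcal{M}(X,\mathcal{A})$. For two ideals $I$ and $J$ in $\mathcal{I}$, the following are equivalent: $I\sim J$; $I\approx J$; $I=J$. Here $I\sim J$ means that the $m_I$-topology equals the $m_J$-topology on $\mathcal{M}(X,\mathcal{A})$, and $I\approx J$ means that the $U_I$-topology equals the $U_J$-topology on $\mathcal{M}(X,\mathcal{A})$.
   Context: $\mathcal{M}(X,\mathcal{A})$ is the commutative ring with unity of all real-valued $\mathcal{A}$-measurable functions on $X$, with pointwise operations. For $g\in\mathcal{M}(X,\mathcal{A})$, $Z(g)=\{x\in X: g(x)=0\}$, and for an ideal $I$, $Z[I]=\{Z(g): g\in I\}$. The measure $\mu$ on $(X,\mathcal{A})$ is the counting measure (so the only null set is $\emptyset$). Null sets $E$ below are members of $\mathcal{A}$. $U_I^+=U_{\mu_I}^+$ is the set of all $u\in\mathcal{M}(X,\mathcal{A})$ for which there exist $Z\in Z[I]$ and $E\subseteq Z$ with $\mu(E)=0$ such that $u(x)>0$ for all $x\in Z\setminus E$. For $f\in\mathcal{M}(X,\mathcal{A})$ and $u\in U_I^+$, $m_I(f,u)$ is the set of all $g\in\mathcal{M}(X,\mathcal{A})$ for which there exist $Z\in Z[I]$ and $E\subseteq Z$ with $\mu(E)=0$ such that $|g(x)-f(x)|<u(x)$ for all $x\in Z\setminus E$. The sets $m_I(f,u)$ form an open base for a topology on $\mathcal{M}(X,\mathcal{A})$, called the $m_I$-topology. For $f\in\mathcal{M}(X,\mathcal{A})$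 and real $\epsilon>0$, $U_I(f,\epsilon)$ is the set of all $g\in\mathcal{M}(X,\mathcal{A})$ such that $\sup_{x\in Z\setminus E}|f(x)-g(x)|<\epsilon$ for some $Z\in Z[I]$ and some $E\subseteq Z$ with $\mu(E)=0$ (the supremum is taken in $[0,\infty]$). The sets $U_I(f,\epsilon)$ form an open base for a topology on $\mathcal{M}(X,\mathcal{A})$, called the $U_I$-topology. *)

(* Defs.v *)
From HB Require Import structures.
From mathcomp Require Import all_boot all_order all_algebra.
From mathcomp Require Import all_classical all_reals all_analysis measurable_realfun.
From mathcomp Require Import lra.

Set Implicit Arguments.
Unset Strict Implicit.
Unset Printing Implicit Defensive.

Import Order.TTheory GRing.Theory Num.Theory.
Import numFieldNormedType.Exports.

Local Open Scope classical_set_scope.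
Local Open Scope ring_scope.

(* The improper ideal is allowed, unlike for [idealr] of ring_quotient, which
   is moreover restricted to boolean predicates. *)
Definition ideal_closed (A : comPzRingType) (I : set A) : Prop :=
  [/\ I 0, forall a b, I a -> I b -> I (a + b) & forall a b, I b -> I (a * b)].

Record ideal (A : comPzRingType) := Ideal {
  ideal_set :> set A;
  idealP : ideal_closed ideal_set }.

Section definitions.
Context {R : realType} {d : measure_display} {X : measurableType d}.
Local Notation M := {mfun X >-> R}.

Definition zero_set (g : M) : set X := [set x | g x = 0].

Definition zero_sets (I : set M) : set (set X) := [set zero_set g | g in I].

Variable mu : {measure set X -> \bar R}.

Definition null_subset (Z E : set X) : Prop :=
  [/\ measurable E, E `<=` Z & mu E = 0%E].

(* U_I^+ *)
Definition mI_units (I : set M) : set M :=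
  [set u : M | exists Z E, [/\ zero_sets I Z, null_subset Z E &
    forall x, (Z `\` E) x -> 0 < u x]].

(* m_I(f, u) *)
Definition mI_ball (I : set M) (f u : M) : set M :=
  [set g : M | exists Z E, [/\ zero_sets I Z, null_subset Z E &
    forall x, (Z `\` E) x -> `|g x - f x| < u x]].

(* [maxe 0] makes the supremum one in [0, +oo]: the library's supremum of the
   empty set is -oo. *)
Definition sup_dist (S : set X) (f g : M) : \bar R :=
  maxe 0%E (ereal_sup [set `|f x - g x|%:E | x in S]).

(* U_I(f, eps) *)
Definition UI_ball (I : set M) (f : M) (eps : R) : set M :=
  [set g : M | exists Z E, [/\ zero_sets I Z, null_subset Z E &
    (sup_dist (Z `\` E) f g < eps%:E)%E]].

Definition mI_base (I : set M) : set (set M) :=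
  [set V | exists f u, mI_units I u /\ V = mI_ball I f u].

Definition UI_base (I : set M) : set (set M) :=
  [set V | exists f eps, 0 < eps /\ V = UI_ball I f eps].

End definitions.

Section bases.
Context {R : realType} {d : measure_display} {X : measurableType d}.
Local Notation M := {mfun X >-> R}.
Variables (mu : {measure set X -> \bar R}) (I : ideal M).

Let ae (P : X -> Prop) := exists Z E, [/\ zero_sets I Z, null_subset mu Z E &
  forall x, (Z `\` E) x -> P x].

Let aeT P : (forall x, P x) -> ae P.
Proof.
move=> HP; have [I0 _ _] := idealP I; exists (zero_set (0 : M)), set0.
split; [by exists 0|by split=> //; rewrite measure0|by move=> x _; exact: HP].
Qed.

Let ae_and P Q : ae P -> ae Q -> ae (fun x => P x /\ Q x).
Proof.
move=> [_ [E1 [[g1 Ig1 <-] [mE1 E1Z E10] H1]]].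
move=> [_ [E2 [[g2 Ig2 <-] [mE2 E2Z E20] H2]]].
have [_ ID IM] := idealP I.
exists (zero_set (g1 * g1 + g2 * g2)).
exists ((E1 `|` E2) `&` zero_set (g1 * g1 + g2 * g2)).
have Zm (g : M) : measurable (zero_set g).
  rewrite -(setTI (zero_set g)).
  exact: (measurable_funPT g measurableT [set 0] (measurable_set1 0)).
have Z12 x : zero_set (g1 * g1 + g2 * g2) x -> g1 x = 0 /\ g2 x = 0.
  rewrite /zero_set /= => H.
  have {}H : g1 x * g1 x + g2 x * g2 x = 0 by [].
  move/eqP: H; rewrite paddr_eq0 -?expr2 ?sqr_ge0// !sqrf_eq0.
  by move=> /andP[/eqP -> /eqP ->].
split.
- by exists (g1 * g1 + g2 * g2) => //; apply: ID; exact: IM.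
- split.
  + by apply: measurableI => //; exact: measurableU.
  + by move=> x [].
  + apply: (subset_measure0 (B := E1 `|` E2)) => //.
    * by apply: measurableI => //; exact: measurableU.
    * exact: measurableU.
    * by apply: etrans E10; apply: measureU0.
- move=> x [Zx nE]; have [z1 z2] := Z12 _ Zx.
  split; [apply: H1|apply: H2]; split=> // Ex; apply: nE; split=> //.
  + by left.
  + by right.
Qed.

Let aeS (P Q : X -> Prop) : (forall x, P x -> Q x) -> ae P -> ae Q.
Proof.
by move=> PQ [Z [E [ZI ZE H]]]; exists Z, E; split=> // x /H; exact: PQ.
Qed.

Lemma UI_ballP (f g : M) (eps : R) : UI_ball mu I f eps g <->
  exists r, [/\ 0 <= r, r < eps & ae (fun x => `|f x - g x| <= r)].
Proof.
split=> [[Z [E [ZI ZE]]]|[r [r0 re [Z [E [ZI ZE H]]]]]]; last first.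
  exists Z, E; split=> //; apply: (@le_lt_trans _ _ r%:E); last by rewrite lte_fin.
  rewrite /sup_dist ge_max lee_fin r0 /=.
  by apply: ge_ereal_sup => _ [x /H Hx <-]; rewrite lee_fin.
set s := sup_dist _ _ _ => se.
have s0 : (0 <= s)%E by rewrite /s /sup_dist le_max lexx.
have sfin : s \is a fin_num by rewrite ge0_fin_numE// (lt_trans se)// ltry.
exists (fine s); split; first exact: fine_ge0.
  by rewrite -lte_fin fineK.
exists Z, E; split=> // x Zx; rewrite -lee_fin fineK//.
by rewrite /s /sup_dist le_max ereal_sup_ubound ?orbT//; exists x.
Qed.

Lemma mI_base_cover : \bigcup_(V in mI_base mu I) V = setT.
Proof.
rewrite -subTset => f _; exists (mI_ball mu I f 1).
  by exists f, 1; split=> //; apply: aeT => x; exact: ltr01.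
by apply: aeT => x; rewrite subrr normr0; exact: ltr01.
Qed.

Lemma mI_base_join (A B : set M) (h : M) : mI_base mu I A -> mI_base mu I B ->
  A h -> B h -> exists V, [/\ mI_base mu I V, V h & V `<=` A `&` B].
Proof.
move=> [f1 [u1 [_ ->]]] [f2 [u2 [_ ->]]] h1 h2.
have [n1 n1E] : exists n : M, forall x, n x = u1 x - `|h x - f1 x|.
  pose n := u1 - ((@Num.norm R R : {mfun R >-> R}) \o (h - f1) : {mfun X >-> R}).
  by exists n.
have [n2 n2E] : exists n : M, forall x, n x = u2 x - `|h x - f2 x|.
  pose n := u2 - ((@Num.norm R R : {mfun R >-> R}) \o (h - f2) : {mfun X >-> R}).
  by exists n.
have [w wE] : exists w : M, forall x, w x = Num.min (n1 x) (n2 x).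
  by exists (n1 \min n2 : {mfun X >-> R}).
have w0 : ae (fun x => 0 < w x).
  apply: aeS (ae_and h1 h2) => x [? ?].
  by rewrite wE n1E n2E lt_min !subr_gt0; apply/andP.
exists (mI_ball mu I h w); split; first by exists h, w.
  by apply: aeS w0 => x; rewrite subrr normr0.
have tri (a b c u : R) : `|a - b| < u - `|b - c| -> `|a - c| < u.
  by rewrite ltrBrDr; apply: le_lt_trans; exact: ler_distD.
move=> g gw; split; apply: aeS gw => x; rewrite wE lt_min n1E n2E.
- by move=> /andP[+ _]; exact: tri.
- by move=> /andP[_]; exact: tri.
Qed.

Lemma UI_base_cover : \bigcup_(V in UI_base mu I) V = setT.
Proof.
rewrite -subTset => f _; exists (UI_ball mu I f 1); first by exists f, 1.
apply/UI_ballP; exists 0; split; [exact: lexx|exact: ltr01|].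
by apply: aeT => x; rewrite subrr normr0.
Qed.

Lemma UI_base_join (A B : set M) (h : M) : UI_base mu I A -> UI_base mu I B ->
  A h -> B h -> exists V, [/\ UI_base mu I V, V h & V `<=` A `&` B].
Proof.
move=> [f1 [e1 [_ ->]]] [f2 [e2 [_ ->]]].
move=> /UI_ballP[r1 [r10 re1 H1]] /UI_ballP[r2 [r20 re2 H2]].
pose e := Num.min (e1 - r1) (e2 - r2).
have e0 : 0 < e by rewrite lt_min !subr_gt0 re1.
exists (UI_ball mu I h e); split; first by exists h, e.
  apply/UI_ballP; exists 0; split=> //.
  by apply: aeT => x; rewrite subrr normr0.
move=> g /UI_ballP[r [r0]]; rewrite lt_min => /andP[rr1 rr2] H.
split; apply/UI_ballP.
- exists (r1 + r); split; [lra|lra|].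
  apply: aeS (ae_and H1 H) => x [? ?].
  by apply: (le_trans (ler_distD (h x) _ _)); exact: lerD.
- exists (r2 + r); split; [lra|lra|].
  apply: aeS (ae_and H2 H) => x [? ?].
  by apply: (le_trans (ler_distD (h x) _ _)); exact: lerD.
Qed.

End bases.

Section topologies.
Context {R : realType} {d : measure_display} {X : measurableType d}.
Local Notation M := {mfun X >-> R}.

(* Copies of the ring of measurable functions carrying the two topologies. *)
Definition mI_space (mu : {measure set X -> \bar R}) (I : ideal M) : Type := M.

Definition UI_space (mu : {measure set X -> \bar R}) (I : ideal M) : Type := M.

HB.instance Definition _ mu I := Choice.on (mI_space mu I).
HB.instance Definition _ mu I := isBaseTopological.Build (mI_space mu I)
  (mI_base_cover mu I) (@mI_base_join _ _ _ mu I).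

HB.instance Definition _ mu I := Choice.on (UI_space mu I).
HB.instance Definition _ mu I := isBaseTopological.Build (UI_space mu I)
  (UI_base_cover mu I) (@UI_base_join _ _ _ mu I).

Definition mI_equiv (I J : ideal M) : Prop :=
  @open (mI_space counting I) = @open (mI_space counting J) :> set (set M).

Definition UI_equiv (I J : ideal M) : Prop :=
  @open (UI_space counting I) = @open (UI_space counting J) :> set (set M).

Lemma open_mIE mu I : @open (mI_space mu I) =
  [set \bigcup_(V in D) V | D in subset^~ (mI_base mu I)] :> set (set M).
Proof. by []. Qed.

Lemma open_UIE mu I : @open (UI_space mu I) =
  [set \bigcup_(V in D) V | D in subset^~ (UI_base mu I)] :> set (set M).
Proof. by []. Qed.

End topologies.

(* Main.v *)
Require Import Defs.
From HB Require Import structures.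
From mathcomp Require Import all_boot all_order all_algebra.
From mathcomp Require Import all_classical all_reals all_analysis measurable_realfun.

(** Both topologies remember the ideal because an ideal of M(X, A) is
    determined by its zero sets.  The ring is von Neumann regular: the pointwise
    inverse with 0^-1 = 0 is measurable, so f belongs to I as soon as Z(f)
    contains a zero set of I, because then f = f * g^-1 * g for some g in I
    ([ideal_zero_subset]).

    Each e in I vanishes on a zero set of I, and zero sets of I are closed under
    finite intersections, so every basic open set of the m_I- or U_I-topology
    that contains 0 contains e as well: e and 0 are topologically
    indistinguishable.  If the topologies of I and J agree, then e and 0 are also
    indistinguishable for J.  Apply this to the idempotent e = f * f^-1 with f in
    I, which is the characteristic function of the complement of Z(f).  The
    ball of radius 1 around 0 for J contains e, so |e| < 1, that is f = 0, on a
    zero set of J, and f is in J.  By symmetry I = J ([ideal_sub_of_bases]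
    treats both topologies at once).  Conversely the two topologies are defined
    from the underlying set of the ideal alone.

    For the counting measure null sets are empty, so the exceptional sets E in
    the definitions of the balls disappear ([counting_null_subset]). *)

Set Implicit Arguments.
Unset Strict Implicit.
Unset Printing Implicit Defensive.

Import Order.TTheory GRing.Theory Num.Theory.
Import numFieldNormedType.Exports.

Local Open Scope classical_set_scope.
Local Open Scope ring_scope.

Section ideals_and_zero_sets.
Context {R : realType} {d : measure_display} {X : measurableType d}.
Local Notation M := {mfun X >-> R}.
Implicit Types (I : ideal M) (f g : M).

(** The real power r `^ (-1) is measurable and sends 0 to 0, but it is the
    inverse only for r >= 0; it is therefore used at f ^ 2. *)
Lemma mfun_inverse f : exists h : M, forall x, h x = (f x)^-1.
Proof.
have mf : measurable_fun setT f by exact: measurable_funPT.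
have mp := measurableT_comp (measurable_powR (-1)) (measurable_funM mf mf).
pose p : M := HB.pack (fun x => (f x * f x) `^ (-1))
  (isMeasurableFun.Build _ _ _ _ _ mp).
exists (f * p) => x; rewrite mfunM /=.
have [->|fx0] := eqVneq (f x) 0; first by rewrite mul0r invr0.
rewrite powR_inv1; last by rewrite -expr2 sqr_ge0.
by rewrite invfM mulrA divff// mul1r.
Qed.

Lemma ideal_zero_subset I f g :
  ideal_set I g -> zero_set g `<=` zero_set f -> ideal_set I f.
Proof.
move=> Ig gf; have [_ _ IM] := idealP I; have [h hE] := mfun_inverse g.
suff -> : f = (f * h) * g by exact: IM.
apply/mfuneqP => x; rewrite -[RHS]/(f x * h x * g x) hE.
have [g0|g0] := eqVneq (g x) 0; last by rewrite mulfVK.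
by rewrite (gf x g0) mul0r mul0r.
Qed.

(** Two conditions, each holding on some zero set of I, thus hold together on a
    single one. *)
Lemma ideal_zero_setI I a b : ideal_set I a -> ideal_set I b ->
  exists2 c : M, ideal_set I c & forall x, c x = 0 -> a x = 0 /\ b x = 0.
Proof.
move=> Ia Ib; have [_ ID IM] := idealP I.
exists (a * a + b * b); first by apply: ID; exact: IM.
move=> x; rewrite -[LHS]/(a x * a x + b x * b x) => /eqP.
rewrite paddr_eq0 -?expr2 ?sqr_ge0// !sqrf_eq0.
by move=> /andP[/eqP -> /eqP ->].
Qed.

Lemma counting_null_subset (Z E : set X) :
  null_subset (counting : {measure set X -> \bar R}) Z E -> E = set0.
Proof.
move=> [_ _]; rewrite /= /counting; case: asboolP => // finE.
move=> /eqP; rewrite eqe pnatr_eq0 => /eqP/finmap.cardfs0_eq E0.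
by rewrite -(fset_setK finE) E0 set_fset0.
Qed.

Lemma on_zero_setP I (P : X -> Prop) :
  (exists Z E, [/\ zero_sets I Z,
     null_subset (counting : {measure set X -> \bar R}) Z E &
     forall x, (Z `\` E) x -> P x]) <->
  exists2 g : M, ideal_set I g & forall x, g x = 0 -> P x.
Proof.
split=> [[_ [E [[g Ig <-] /counting_null_subset -> H]]]|[g Ig H]].
  by exists g => // x gx0; apply: H; split.
exists (zero_set g), set0; split; first by exists g.
- by split=> //; rewrite measure0.
- by move=> x [/H].
Qed.

(** Equality of the topologies generated by two bases transports the
    indistinguishability of 0 from every e in I.  The hypothesis on [BJ] asks
    only for one neighbourhood of 0 whose members are smaller than 1 on a
    zero set of J: an idempotent smaller than 1 vanishes. *)
Lemma ideal_sub_of_bases I J (BI BJ : set (set M)) :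
  (forall V e, BI V -> V 0 -> ideal_set I e -> V e) ->
  (exists V, [/\ BJ V, V 0 & forall e, V e ->
     exists2 g : M, ideal_set J g & forall x, g x = 0 -> `|e x| < 1]) ->
  [set \bigcup_(V in D) V | D in subset^~ BI] =
  [set \bigcup_(V in D) V | D in subset^~ BJ] ->
  ideal_set I `<=` ideal_set J.
Proof.
move=> BI_e [V [BJV V0 V1]] top_eq f If.
have [h hE] := mfun_inverse f.
have Ie : ideal_set I (h * f) by have [_ _] := idealP I; exact.
have [D DBI DV] : [set \bigcup_(V in D) V | D in subset^~ BI] V.
  by rewrite top_eq; exists [set V] => [_ ->//|]; rewrite bigcup_set1.
have [g Jg g1] : exists2 g : M, ideal_set J g & forall x, g x = 0 -> `|(h * f) x| < 1.
  apply: V1; move: V0; rewrite -DV => -[W DW W0].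
  by exists W => //; apply: BI_e => //; exact: DBI.
apply: (ideal_zero_subset Jg) => x gx0; have := g1 x gx0.
rewrite mfunM /= hE; have [//|fx0] := eqVneq (f x) 0.
by rewrite mulVf// normr1 ltxx.
Qed.

Lemma mI_base_zero I (V : set M) (e : M) :
  mI_base counting I V -> V 0 -> ideal_set I e -> V e.
Proof.
move=> [f [u [_ ->]]] /on_zero_setP[g Ig g0] Ie.
have [c Ic c0] := ideal_zero_setI Ig Ie.
apply/on_zero_setP; exists c => // x /c0[gx0 ex0].
by have := g0 x gx0; rewrite ex0.
Qed.

Lemma UI_base_zero I (V : set M) (e : M) :
  UI_base counting I V -> V 0 -> ideal_set I e -> V e.
Proof.
move=> [f [r [_ ->]]] /UI_ballP[s [s0 sr /on_zero_setP[g Ig g0]]] Ie.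
have [c Ic c0] := ideal_zero_setI Ig Ie.
apply/UI_ballP; exists s; split=> //; apply/on_zero_setP.
by exists c => // x /c0[gx0 ex0]; have := g0 x gx0; rewrite ex0.
Qed.

Lemma mI_base_unit_ball I : exists V : set M,
  [/\ mI_base counting I V, V 0 & forall e, V e ->
     exists2 g : M, ideal_set I g & forall x, g x = 0 -> `|e x| < 1].
Proof.
have [I0 _ _] := idealP I; exists (mI_ball counting I 0 1); split.
- exists 0, 1; split=> //; apply/on_zero_setP.
  by exists 0 => // x _; exact: ltr01.
- apply/on_zero_setP; exists 0 => // x _.
  by rewrite subrr normr0; exact: ltr01.
- move=> e /on_zero_setP[g Ig g1]; exists g => // x /g1.
  by rewrite subr0.
Qed.

Lemma UI_base_unit_ball I : exists V : set M,
  [/\ UI_base counting I V, V 0 & forall e, V e ->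
     exists2 g : M, ideal_set I g & forall x, g x = 0 -> `|e x| < 1].
Proof.
have [I0 _ _] := idealP I; exists (UI_ball counting I 0 1); split.
- by exists 0, 1.
- apply/UI_ballP; exists 0; split=> //; apply/on_zero_setP.
  by exists 0 => // x _; rewrite subrr normr0.
- move=> e /UI_ballP[s [_ s1 /on_zero_setP[g Ig gs]]]; exists g => // x /gs.
  by rewrite sub0r normrN => /le_lt_trans; exact.
Qed.

Lemma mI_equiv_eq I J : mI_equiv I J -> ideal_set I = ideal_set J.
Proof.
rewrite /mI_equiv !open_mIE => IJ; apply/seteqP; split.
- exact: ideal_sub_of_bases (@mI_base_zero I) (mI_base_unit_ball J) IJ.
- exact: ideal_sub_of_bases (@mI_base_zero J) (mI_base_unit_ball I) (esym IJ).
Qed.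

Lemma UI_equiv_eq I J : UI_equiv I J -> ideal_set I = ideal_set J.
Proof.
rewrite /UI_equiv !open_UIE => IJ; apply/seteqP; split.
- exact: ideal_sub_of_bases (@UI_base_zero I) (UI_base_unit_ball J) IJ.
- exact: ideal_sub_of_bases (@UI_base_zero J) (UI_base_unit_ball I) (esym IJ).
Qed.

End ideals_and_zero_sets.

(* A [measurableType] is a pointed type, so X is non-empty. *)
Theorem theorem4p5 (R : realType) (d : measure_display) (X : measurableType d)
    (I J : ideal {mfun X >-> R}) :
  [<-> mI_equiv I J; UI_equiv I J; ideal_set I = ideal_set J].
Proof.
tfae.
- by move=> /mI_equiv_eq IJ; rewrite /UI_equiv !open_UIE IJ.
- exact: UI_equiv_eq.
- by move=> IJ; rewrite /mI_equiv !open_mIE IJ.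
Qed.
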